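(* Let $(\mathcal A,\bullet)$ be the symmetric Leibniz algebra obtained from a Lie algebra $(\mathcal A,[\,,])$ by means of $\rho$, let $\omega\in\wedge^2\mathcal A^*$, and let $Z(\mathcal A)$ be the center of $(\mathcal A,[\,,])$. Then $\omega$ is bi-symplectic if and only if $(\mathcal A,[\,,],\omega)$ is a symplectic Lie algebra and there exist a symmetric 3-linear form $T:\mathcal A\times\mathcal A\times\mathcal A\to\mathbb K$ and a totally isotropic vector subspace $I\subset Z(\mathcal A)$ such that $T(I^\perp,\cdot,\cdot)=0$ and $$\omega(\rho(u,v),w)=T(u,v,w),\qquad u,v,w\in\mathcal A.$$
   Context: All algebras are finite-dimensional over a field $\mathbb K$ of characteristic $0$. For an algebra $(\mathcal A,\bullet)$: $\mathrm L_uv=u\bullet v$, $\mathrm R_uv=v\bullet u$. It is left Leibniz if $\mathrm L_{u\bullet v}=[\mathrm L_u,\mathrm L_v]$, right Leibniz if $\mathrm R_{w\bullet u}=-[\mathrm R_w,\mathrm R_u]$, and symmetric Leibniz if both. Symmetric Leibniz algebras are exactly the products $u\bullet v=[u,v]+\rho(u,v)$ where $[\,,]$ is a Lie bracket on $\mathcal A$ (so $[u,v]=\frac12(u\bullet v-v\bullet u)$) and $\rho:\mathcal A\times\mathcal A\to Z(\mathcal A)$ is a symmetric bilinear map with $\rho([u,v],w)=\rho(\rho(u,v),w)=0$ for all $u,v,w$; one says $(\mathcal A,\bullet)$ is obtained from $(\mathcal A,[\,,])$ by means of $\rho$. A form $\omega$ on a symmetric Leibniz algebra is bi-symplectic if it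 is a nondegenerate skew-symmetric bilinear form such that, for all $u,v$, both $\mathrm L_v^*u-\mathrm L_u^*v=[u,v]$ (symplectic for the left Leibniz structure) and $\mathrm R_v^*u-\mathrm R_u^*v=-[u,v]$ (symplectic for the right Leibniz structure), where $^*$ is the adjoint with respect to $\omega$. A symplectic Lie algebra is a Lie algebra with a nondegenerate skew-symmetric bilinear form satisfying $\omega([u,v],w)+\omega([v,w],u)+\omega([w,u],v)=0$. $I^\perp$ is the orthogonal of $I$ with respect to $\omega$; $I$ is totally isotropic if $I\subset I^\perp$. *)

(* Defs.v *)
From HB Require Import structures.
From mathcomp Require Import all_boot all_algebra.
From mathcomp Require Import sesquilinear.

Set Implicit Arguments.
Unset Strict Implicit.
Unset Printing Implicit Defensive.

Import GRing.Theory.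
Local Open Scope ring_scope.

Section SymmetricLeibniz.
Variables (K : fieldType) (A : vectType K).
Implicit Types (mul br rho : {bilinear A -> A -> A}) (om : {skew_symmetric A}).
Implicit Types (f g : 'End(A)) (u v w : A).

Definition lmul mul u : 'End(A) := linfun (mul u).
Definition rmul mul u : 'End(A) := linfun (applyr mul u).

Definition end_comm f g : 'End(A) := (f \o g)%VF - (g \o f)%VF.

Definition left_leibniz mul : Prop :=
  forall u v, lmul mul (mul u v) = end_comm (lmul mul u) (lmul mul v).

Definition right_leibniz mul : Prop :=
  forall w u, rmul mul (mul w u) = - end_comm (rmul mul w) (rmul mul u).

Definition symmetric_leibniz mul : Prop := left_leibniz mul /\ right_leibniz mul.

Definition bracket mul u v : A := 2^-1 *: (mul u v - mul v u).

Definition lie_bracket br : Prop :=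
  (forall u, br u u = 0) /\
  (forall u v w, br u (br v w) + br v (br w u) + br w (br u v) = 0).

(* The kernel of the linear map u |-> ad_u; see mem_lie_centerP. *)
Definition lie_center br : {vspace A} := lker (linfun (lmul br)).

Definition obtained_by_means_of mul br rho : Prop :=
  [/\ forall u v, rho u v = rho v u,
      forall u v, rho u v \in lie_center br,
      forall u v w, rho (br u v) w = 0,
      forall u v w, rho (rho u v) w = 0
    & forall u v, mul u v = br u v + rho u v].

(* flat om u is the linear form om(u, .); the adjoint of f sends u to the
   preimage under flat om of the linear form om(u, f .).  This is meaningful
   only for nondegenerate om; see adjointP and adjoint_uniq. *)
Definition flat om u : 'Hom(A, K^o) := linfun (om u : A -> K^o).
Definition adjoint om f : A -> A :=
  fun u => ((linfun (flat om))^-1)%VF (flat om u \o f)%VF.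

Definition left_symplectic mul om : Prop :=
  nondegenerate om /\
  forall u v, adjoint om (lmul mul v) u - adjoint om (lmul mul u) v
              = bracket mul u v.

Definition right_symplectic mul om : Prop :=
  nondegenerate om /\
  forall u v, adjoint om (rmul mul v) u - adjoint om (rmul mul u) v
              = - bracket mul u v.

Definition bi_symplectic mul om : Prop :=
  left_symplectic mul om /\ right_symplectic mul om.

Definition symplectic_lie br om : Prop :=
  [/\ lie_bracket br, nondegenerate om
    & forall u v w, om (br u v) w + om (br v w) u + om (br w u) v = 0].

(* The two transpositions generate all permutations of the arguments. *)
Definition symmetric_trilinear (T : A -> A -> A -> K) : Prop :=
  [/\ forall v w, scalar (fun u => T u v w),
      forall u w, scalar (fun v => T u v w),
      forall u v, scalar (T u v),
      forall u v w, T u v w = T v u w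
    & forall u v w, T u v w = T u w v].

Lemma lmulE mul u v : lmul mul u v = mul u v.
Proof. by rewrite lfunE. Qed.

Lemma rmulE mul u v : rmul mul u v = mul v u.
Proof. by rewrite lfunE. Qed.

Fact lmul_is_linear mul : linear (lmul mul).
Proof.
move=> a u v; apply/lfunP => w.
by rewrite add_lfunE scale_lfunE !lmulE linearPl.
Qed.
HB.instance Definition _ mul :=
  GRing.isLinear.Build K A 'End(A) *:%R (lmul mul) (lmul_is_linear mul).

Lemma mem_lie_centerP br z :
  reflect (forall u, br z u = 0) (z \in lie_center br).
Proof.
rewrite memv_ker lfunE /=; apply: (iffP eqP) => [z0 u|z0].
  by rewrite -lmulE z0 lfunE.
by apply/lfunP => u; rewrite lmulE z0 lfunE.
Qed.

Lemma flatE om u v : flat om u v = om u v.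
Proof. by rewrite lfunE. Qed.

Fact flat_is_linear om : linear (flat om).
Proof.
move=> a u v; apply/lfunP => w.
by rewrite add_lfunE scale_lfunE !flatE linearPl.
Qed.
HB.instance Definition _ om :=
  GRing.isLinear.Build K A 'Hom(A, K^o) *:%R (flat om) (flat_is_linear om).

Lemma nondegenerateP om :
  reflect (forall u, (forall v, om u v = 0) -> u = 0) (nondegenerate om).
Proof.
apply: (iffP idP) => [/eqP nd u u0|nd].
  apply/eqP; rewrite -memv0 -nd; apply/mem_orthovP => v _; exact: u0.
rewrite /nondegenerate -subv0; apply/subvP => u /mem_orthovP u0.
by rewrite memv0; apply/eqP/nd => v; rewrite u0 ?memvf.
Qed.

Lemma adjointP om f u v :
  nondegenerate om -> om (adjoint om f u) v = om u (f v).
Proof.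
move=> /nondegenerateP nd; pose F := linfun (flat om).
have kF : lker F = 0%VS.
  apply/eqP; rewrite -subv0; apply/subvP => x.
  rewrite memv_ker lfunE /= memv0 => /eqP x0; apply/eqP/nd => y.
  by rewrite -flatE x0 lfunE.
have limF : limg F = fullv.
  apply/eqP; rewrite eqEdim subvf /= limg_dim_eq ?kF ?capv0 //.
  by rewrite !dimvf /dim /= muln1.
have inF : (flat om u \o f)%VF \in limg F by rewrite limF memvf.
have : F (adjoint om f u) = (flat om u \o f)%VF by rewrite limg_lfunVK.
rewrite lfunE /= => /lfunP/(_ v).
by rewrite comp_lfunE !flatE.
Qed.

Lemma adjoint_uniq om f (h : A -> A) :
  nondegenerate om -> (forall u v, om (h u) v = om u (f v)) ->
  h =1 adjoint om f.
Proof.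
move=> nd hP u; apply/eqP; rewrite -subr_eq0; apply/eqP.
by move/nondegenerateP: (nd); apply=> v; rewrite linearBl /= hP adjointP ?subrr.
Qed.

Lemma obtained_symmetric_leibniz mul br rho :
  lie_bracket br -> obtained_by_means_of mul br rho -> symmetric_leibniz mul.
Proof.
move=> [br0 jac] [rhoC rhoZ rhobr rhorho mulE].
have brC u v : br u v = - br v u.
  apply/eqP; rewrite -addr_eq0; have := br0 (u + v).
  by rewrite linearDl !linearDr !br0 add0r addr0 => ->.
have Zl u v w : br (rho u v) w = 0 by apply/mem_lie_centerP.
have Zr u v w : br w (rho u v) = 0 by rewrite brC Zl oppr0.
have rhobr' u v w : rho w (br u v) = 0 by rewrite rhoC rhobr.
have rhorho' u v w : rho w (rho u v) = 0 by rewrite rhoC rhorho.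
have mm u v w : mul u (mul v w) = br u (br v w).
  by rewrite !mulE !linearDr rhobr' rhorho' Zr !addr0.
have mm' u v w : mul (mul v w) u = br (br v w) u.
  by rewrite !mulE !linearDl rhobr rhorho Zl !addr0.
have jac' u v w : br (br u v) w = br u (br v w) - br v (br u w).
  have := jac u v w; rewrite (brC w (br u v)) (brC w u) linearNr.
  by move/eqP; rewrite subr_eq0 => /eqP <-.
split=> [u v|w u]; apply/lfunP => x.
  by rewrite /end_comm add_lfunE opp_lfunE !comp_lfunE !lmulE !mm mm' jac'.
rewrite /end_comm opp_lfunE add_lfunE opp_lfunE !comp_lfunE !rmulE mm !mm'.
by rewrite opprB jac' (brC (br x u) w) opprK subrK.
Qed.

End SymmetricLeibniz.

(* Main.v *)
Require Import Defs.
From HB Require Import structures.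
From mathcomp Require Import all_boot all_algebra.
From mathcomp Require Import sesquilinear.
From mathcomp Require Import ring.

Set Implicit Arguments.
Unset Strict Implicit.
Unset Printing Implicit Defensive.

Import GRing.Theory.
Local Open Scope ring_scope.

(** Pairing both symplectic conditions with a vector w turns them into
    [(a + p) - (b + q) = c] and [(p - a) - (q - b) = - c], where
    [a = om u [v,w]], [b = om v [u,w]], [c = om [u,v] w], [p = om u (rho v w)]
    and [q = om v (rho u w)].  As 2 is invertible this means [a - b = c], the
    cocycle identity, and [p = q], which together with the symmetry of rho says
    that [om (rho u v) w] is totally symmetric.  The subspace I is the span of
    the values of rho: it is isotropic because
    [om (rho u v) (rho x y) = om (rho (rho x y) u) v = 0]. *)

Section BilinearSpan.
Variables (K : fieldType) (A : vectType K) (rho : {bilinear A -> A -> A}).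

(** The values of [rho] need not form a subspace. By linearity in the first argument, basis vectors
    suffice there, so a finite sum of images gives their span. *)
Definition bilinear_span : {vspace A} :=
  (\sum_(i < \dim {:A}) limg (lmul rho (vbasis {:A})`_i))%VS.

Lemma mem_bilinear_span u v : rho u v \in bilinear_span.
Proof.
rewrite -lmulE (coord_vbasis (memvf u)) linear_sum sum_lfunE.
apply: memv_sumr => i _.
by rewrite linearZ scale_lfunE rpredZ // memv_img ?memvf.
Qed.

Lemma bilinear_span_subvP (U : {vspace A}) :
  reflect (forall u v, rho u v \in U) (bilinear_span <= U)%VS.
Proof.
apply: (iffP idP) => [/subvP sU u v|rhoU]; first exact/sU/mem_bilinear_span.
apply/subv_sumP => i _; apply/subvP => _ /memv_imgP[v _ ->].
by rewrite lmulE.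
Qed.

End BilinearSpan.

Lemma pchar0_mul2_eq0 (K : fieldType) (x : K) :
  [pchar K] =i pred0 -> x + x = 0 -> x = 0.
Proof.
move=> /pcharf0P charK0 /eqP; rewrite -mulr2n -mulr_natl mulf_eq0.
by rewrite charK0 => /eqP.
Qed.

Lemma skew_symmetricN (K : fieldType) (A : vectType K)
  (om : {skew_symmetric A}) u v : om u v = - om v u.
Proof. by rewrite hermC expr1 mulN1r. Qed.

Lemma lie_bracketN (K : fieldType) (A : vectType K)
  (br : {bilinear A -> A -> A}) :
  lie_bracket br -> forall u v, br u v = - br v u.
Proof.
move=> [br0 _] u v; apply/eqP; rewrite -addr_eq0; have := br0 (u + v).
by rewrite linearDl !linearDr !br0 add0r addr0 => ->.
Qed.

(** Nondegeneracy lets the vector identity be tested against every [w]. Leaving [f] and [g]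
    arbitrary covers left and right multiplications at once. *)
Lemma adjoint_subE (K : fieldType) (A : vectType K) (om : {skew_symmetric A})
  (f : A -> 'End(A)) (g : A -> A -> A) : nondegenerate om ->
  (forall u v, adjoint om (f v) u - adjoint om (f u) v = g u v) <->
  (forall u v w, om u (f v w) - om v (f u w) = om (g u v) w).
Proof.
move=> nd; split=> [adj u v w|adj u v].
  by rewrite -adj linearBl /= !adjointP.
apply/eqP; rewrite -subr_eq0; apply/eqP.
move/nondegenerateP: (nd); apply=> w.
by rewrite !linearBl /= !adjointP // adj subrr.
Qed.

(** Antisymmetrizing [mul] cancels the symmetric [rho] and doubles [br]. *)
Lemma bracket_obtained (K : fieldType) (A : vectType K)
  (mul br rho : {bilinear A -> A -> A}) : [pchar K] =i pred0 ->
  lie_bracket br -> obtained_by_means_of mul br rho ->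
  forall u v, bracket mul u v = br u v.
Proof.
move=> /pcharf0P charK0 /lie_bracketN brN [rhoC _ _ _ mulE] u v.
rewrite /bracket !mulE (rhoC v u) (brN v u) opprD opprK addrACA subrr addr0.
by rewrite -mulr2n -scaler_nat scalerA mulVf ?charK0 // scale1r.
Qed.

Lemma bi_symplecticE (K : fieldType) (A : vectType K)
  (mul br rho : {bilinear A -> A -> A}) (om : {skew_symmetric A}) :
  [pchar K] =i pred0 -> lie_bracket br -> obtained_by_means_of mul br rho ->
  bi_symplectic mul om <->
  symplectic_lie br om /\ forall u v w, om u (rho v w) = om v (rho u w).
Proof.
move=> charK0 lie_br mul_br_rho.
have brN := lie_bracketN lie_br.
have brE := bracket_obtained charK0 lie_br mul_br_rho.
have [rhoC _ _ _ mulE] := mul_br_rho.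
have cocycleE u v w : om (br u v) w + om (br v w) u + om (br w u) v =
    om (br u v) w - (om u (br v w) - om v (br u w)).
  rewrite (skew_symmetricN om (br v w)) (skew_symmetricN om (br w u)).
  by rewrite (brN w u) linearNr opprK; ring.
have lE u v w : om u (lmul mul v w) - om v (lmul mul u w) =
    om u (br v w) - om v (br u w) + (om u (rho v w) - om v (rho u w)).
  by rewrite !lmulE !mulE !linearDr /=; ring.
(* Right multiplication swaps the factors: the [br] part changes sign, the [rho] part does not. *)
have rE u v w : om u (rmul mul v w) - om v (rmul mul u w) =
    - (om u (br v w) - om v (br u w)) + (om u (rho v w) - om v (rho u w)).
  rewrite !rmulE !mulE !linearDr /= (brN w v) (brN w u) !linearNr.
  by rewrite (rhoC w v) (rhoC w u); ring.
split=> [[[nd /adjoint_subE L] [_ /adjoint_subE R]]|[[_ nd cocycle] rhoS]].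
  have {}L u v w := L nd u v w; have {}R u v w := R nd u v w.
  have rhoS u v w : om u (rho v w) = om v (rho u w).
    (* In the sum of [lE] and [rE] the bracket terms cancel on both sides, leaving twice the wanted
       difference. *)
    apply/subr0_eq/(pchar0_mul2_eq0 charK0).
    have := lE u v w; rewrite L => l; have := rE u v w; rewrite R linearNl => r.
    have /eqP := f_equal2 +%R l r; rewrite subrr eq_sym => /eqP <-.
    by ring.
  split=> //; split=> // u v w.
  by rewrite cocycleE -brE -L lE (rhoS u) subrr addr0 subrr.
have brS u v w : om u (br v w) - om v (br u w) = om (bracket mul u v) w.
  by rewrite brE; apply/esym/subr0_eq; rewrite -cocycleE.
split; split=> //; apply/(adjoint_subE _ _ nd) => u v w.
  by rewrite lE brS (rhoS u) subrr addr0.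
by rewrite rE brS (rhoS u) subrr addr0 linearNl.
Qed.

Theorem theorem3p2 (K : fieldType) (charK0 : [pchar K] =i pred0)
  (A : vectType K) (mul br rho : {bilinear A -> A -> A})
  (lie_br : lie_bracket br) (mul_br_rho : obtained_by_means_of mul br rho)
  (om : {skew_symmetric A}) :
  bi_symplectic mul om <->
  symplectic_lie br om /\
  exists (T : A -> A -> A -> K) (I : {vspace A}),
    [/\ symmetric_trilinear T,
        (I <= lie_center br)%VS,
        (I <= orthov om I)%VS,
        {in orthov om I, forall x, forall v w, T x v w = 0}
      & forall u v w, om (rho u v) w = T u v w].
Proof.
rewrite (bi_symplecticE om charK0 lie_br mul_br_rho).
have [rhoC rhoZ _ rhorho _] := mul_br_rho.
split=> -[sympl]; last first.
  move=> [T [I [[_ _ _ TC12 TC23] _ _ _ TE]]]; split=> // u v w.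
  (* Both sides become [T] of permuted arguments, up to the same sign. *)
  rewrite (skew_symmetricN om u) (skew_symmetricN om v) !TE.
  by rewrite (TC23 v) (TC12 v) (TC23 u w).
move=> rhoS; split=> //.
(* Together with [rhoC], this transposition yields full symmetry of the form. *)
have TC23 u v w : om (rho u v) w = om (rho u w) v.
  rewrite (skew_symmetricN om _ w) (skew_symmetricN om _ v).
  by rewrite (rhoC u v) (rhoC u w) rhoS.
exists (fun u v w => om (rho u v) w), (bilinear_span rho); split=> //.
- split=> // [v w a x y|u w a x y|u v a x y|u v w].
  + by rewrite linearPl linearPl.
  + by rewrite linearPr linearPl.
  + by rewrite linearPr.
  + by rewrite rhoC.
- exact/bilinear_span_subvP.
(* The span criterion is applied in each argument of [om], with symmetry of orthogonality in
   between, so only values of [rho] need be paired. *)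
- apply/bilinear_span_subvP => u v; rewrite mem_orthov_sym.
  apply/bilinear_span_subvP => x y; rewrite mem_orthov1.
  by rewrite TC23 (rhoC x) rhorho linear0l.
(* Permuting the arguments pairs [x] with [rho v w], which lies in the span. *)
- move=> x /mem_orthovP xI v w.
  by rewrite rhoC TC23 skew_symmetricN xI ?oppr0 ?mem_bilinear_span.
Qed.
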